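(* Let $p$ denote the size of a bubble and let $x=p/(n-1)$. The asymptotic distribution $\rho(x)$ of the size of bubbles, excluding diagrams which are themselves bubbles, is given for $x\in(0,2]$ by $$\rho(x)=\lim_{n\to\infty}\frac{(n-1)\,B_{n,\lfloor x(n-1)\rfloor}}{\sum_{p=1}^{2n-2}B_{n,p}}=\frac{e\,(6-x)}{2\,(4e-2)}\,e^{-x/2}.$$ That is, for every fixed real $x\in(0,2]$ the limit exists and equals the stated value.
   Context: A linear chord diagram on $2n$ vertices is a perfect matching of the linearly ordered set of vertices $\{1,2,\dots,2n\}$; its $n$ pairs are called chords. A short chord is a chord joining two adjacent vertices $i,i+1$. A bubble of a linear chord diagram is a nonempty maximal set of consecutive vertices none of which is an endpoint of a short chord (so a bubble is bounded on each side by a short chord or by an end of the diagram; its vertices may be joined by non-short chords to one another or to vertices outside the bubble). The size of a bubble is the number of its vertices. $B_{n,p}$ denotes the total number of bubbles of size $p$, counted across all $(2n-1)!!$ linear chord diagrams on $2n$ vertices. A bubble of size $2n$ is an entire diagram with no short chords, and $B_{n,2n-1}=0$; the sum over $1\le p\le 2n-2$ thus excludes diagrams which are themselves bubbles. Here $e$ is the base of the natural logarithm. *)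

(* Defs.v *)
From mathcomp Require Import all_boot.
Set Implicit Arguments.
Unset Strict Implicit.
Unset Printing Implicit Defensive.

Local Open Scope nat_scope.

(* The vertices are numbered 0, ..., 2n-1 instead of 1, ..., 2n; a diagram is
   the set of its chords, each chord being the pair of its endpoints. *)
Definition chord_diagram (n : nat) (D : {set {set 'I_(2 * n)}}) : bool :=
  partition D [set: 'I_(2 * n)] && [forall c in D, #|c| == 2].

Definition short_chord (m : nat) (c : {set 'I_m}) : bool :=
  [exists i : 'I_m, exists j : 'I_m,
    (j == i.+1 :> nat) && (c == [set i; j])].

Definition short_endpoint (m : nat) (D : {set {set 'I_m}}) (i : 'I_m) : bool :=
  [exists c in D, short_chord c && (i \in c)].

Definition consecutive (m : nat) (A : {set 'I_m}) : bool :=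
  [forall i in A, forall k in A, forall j : 'I_m,
    (i <= j <= k) ==> (j \in A)].

Definition bubble (m : nat) (D : {set {set 'I_m}}) (A : {set 'I_m}) : bool :=
  (A != set0) &&
  maxset (fun S : {set 'I_m} =>
            consecutive S && [forall i in S, ~~ short_endpoint D i]) A.

Definition bubble_count (n p : nat) : nat :=
  \sum_(D : {set {set 'I_(2 * n)}} | chord_diagram D)
    #|[set A : {set 'I_(2 * n)} | bubble D A & #|A| == p]|.

(* Main.v *)
Require Import Defs.
From HB Require Import structures.
From mathcomp Require Import all_boot all_order all_algebra.
From mathcomp Require Import zify ring lra.
Import Order.TTheory GRing.Theory Num.Theory.
Set Implicit Arguments.
Unset Strict Implicit.
Unset Printing Implicit Defensive.
Local Open Scope nat_scope.

(** Write (2m-1)!! for the number of perfect matchings of 2m points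
    ([matching_number m]), and G(m, p) for the number of those in which no two
    successive vertices of a given path on p of the points are matched.  The
    position of the path is irrelevant: removing the first edge {v, w} of the
    path gives

      G(m + 1, p + 2) = G(m + 1, p + 1) - G(m, p),

    since the matchings that contain {v, w} are those of the other 2m points,
    with the rest of the path to avoid ([card_avoiding_cons2]).  Together with
    G(m, 0) = G(m, 1) = (2m - 1)!! this determines G, and the solution is the inclusion-exclusion sum

      G(m, p) = sum over k of (-1)^k C(p - k, k) (2m - 2k - 1)!!,

    which is [avoiding_number].

    A block of p consecutive vertices is a bubble exactly when no short chord
    lies inside it and each of its sides is an end of the diagram or is
    flanked by a short chord ([bubble_blockE]).  For 1 <= p <= 2n - 2 there
    are two blocks touching an end, each with one forced chord, and 2n - 3 - p
    inner blocks, each with two, so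

      B(n, p) = 2 G(n - 1, p) + (2n - 3 - p) G(n - 2, p)

    ([bubble_count_avoiding]).  The recurrence for G makes the sums over p
    telescope and gives the exact total ([sum_bubble_count])

      sum of B(n, p) for 1 <= p <= 2n - 2
        = 2 (2n - 1)!! - G(n, 2n) - 3 (2n - 3)!!.

    All asymptotics thus reduce to one limit: if p <= 2m and p = x m + O(1),
    then G(m, p) / (2m - 1)!! tends to e^(-x/2).  The k-th term of the ratio
    tends to (-x/2)^k / k! and is at most 1 / k! in absolute value, so the sum
    may be passed to the limit term by term ([tannery],
    [cvg_avoiding_ratio]).  After division by (2n - 1)!!, the total tends to
    2 - 1/e, and (n - 1) B(n, p) tends to
    (1 + (2 - x) / 4) e^(-x/2): the end blocks give the 1, the inner blocks
    the rest. *)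

(** * Perfect matchings avoiding the edges of a path *)

Definition perfect_matching (T : finType) (A : {set T}) (D : {set {set T}}) :=
  partition D A && [forall c in D, #|c| == 2].

Definition avoids (T : finType) (D : {set {set T}}) (s : seq T) :=
  sorted (fun x y => [set x; y] \notin D) s.

(** The double factorial (2m - 1)!!. *)
Fixpoint matching_number (m : nat) : nat :=
  if m is m'.+1 then m'.*2.+1 * matching_number m' else 1.

Lemma pair_notin_matchingD (T : finType) (A c : {set T}) (D : {set {set T}})
    (x y : T) :
  perfect_matching (A :\: c) D -> x \in c -> [set x; y] \notin D.
Proof.
case/andP=> pD _ xc; apply/negP=> /(partitionS pD)/subsetP/(_ x).
by rewrite !inE eqxx xc => /(_ isT).
Qed.

(** Adding the chord [c] back to a matching of the other points is a bijection onto
    the matchings that contain [c]; this is what makes every count below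
    inductive without relabelling any vertex. *)
Lemma card_matchings_through (T : finType) (A c : {set T})
    (P : pred {set {set T}}) : c \subset A -> #|c| = 2 ->
  #|[set D | perfect_matching A D && ((c \in D) && P D)]| =
  #|[set D | perfect_matching (A :\: c) D && P (c |: D)]|.
Proof.
move=> cA c2.
have c0 : c != set0 by rewrite -card_gt0 c2.
have cN D : perfect_matching (A :\: c) D -> c \notin D.
  have [x xc] := set0Pn _ c0.
  case/andP=> pD _; apply/negP=> /(partitionS pD)/subsetP/(_ x xc).
  by rewrite inE xc.
have inj : {in [set D | perfect_matching (A :\: c) D && P (c |: D)] &,
    injective (fun D => c |: D)}.
  move=> D E; rewrite !inE => /andP[/cN cD _] /andP[/cN cE _] DE.
  by rewrite -(setU1K cD) DE setU1K.
rewrite -(card_in_imset inj); apply: eq_card => D.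
apply/idP/imsetP; rewrite inE.
  case/and3P=> /andP[pD /forall_inP D2] cD PD.
  exists (D :\ c); rewrite ?inE setD1K // PD andbT.
  rewrite /perfect_matching partitionD1 //=.
  by apply/forall_inP=> d /setD1P[_ /D2].
case=> E; rewrite inE => /andP[/andP[pE /forall_inP E2] PE] ->.
rewrite PE setU11 !andbT; apply/andP; split.
  have -> : A = c :|: (A :\: c).
    by rewrite -{1}(setID A c) (setIidPr cA).
  apply: partitionU1 => //.
  by rewrite -setI_eq0 setIDA setIC -setIDA setDv setI0.
by apply/forall_inP=> d /setU1P[->|/E2 //]; rewrite c2.
Qed.

Lemma card_setD_pair (T : finType) (A c : {set T}) (m : nat) :
  c \subset A -> #|c| = 2 -> #|A| = m.+1.*2 -> #|A :\: c| = m.*2.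
Proof. by move=> cA c2 Am; rewrite cardsD (setIidPr cA) c2 Am doubleS subn2. Qed.

(** A fixed point [v] lies in exactly one chord {v, w}, and each of the
    2m - 1 choices of [w] leaves a matching of the remaining points. *)
Lemma card_matchings (T : finType) (A : {set T}) (m : nat) :
  #|A| = m.*2 -> #|[set D | perfect_matching A D]| = matching_number m.
Proof.
elim: m A => [|m IH] A.
  move/eqP; rewrite double0 cards_eq0 => /eqP ->.
  rewrite -[RHS](cards1 (set0 : {set {set T}})); apply: eq_card => D.
  rewrite !inE /perfect_matching partition_set0.
  by case: eqP => // ->; apply/forall_inP=> c; rewrite inE.
move=> Am; have [v vA] : exists v, v \in A.
  by apply/set0Pn; rewrite -card_gt0 Am doubleS.
(* Each matching is counted once in the sum over the partners w of v. *)
have step (D : {set {set T}}) : perfect_matching A D ->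
    \sum_(w in A :\ v) ([set v; w] \in D) = 1.
  case/andP=> pD /forall_inP D2.
  have: v \in cover D by rewrite (cover_partition pD).
  case/bigcupP=> c cD vc.
  have /cards2P[x [y [nxy Ec]]] := D2 c cD.
  have [w nvw Ew] : exists2 w, v != w & c = [set v; w].
    move: vc; rewrite Ec !inE => /orP[]/eqP->; first by exists y.
    by exists x; rewrite 1?eq_sym // setUC.
  have wA : w \in A.
    by apply: (subsetP (partitionS pD cD)); rewrite Ew !inE eqxx orbT.
  rewrite (bigD1 w) /=; last by rewrite !inE wA eq_sym nvw.
  rewrite -Ew cD big1 // => u /andP[_ nuw].
  apply/eqP; rewrite eqb0; apply: contraNN nuw => vuD.
  have: [set v; u] = c.
    apply/eqP; apply: contraTT vc => ne.
    have /trivIsetP tD := partition_trivIset pD.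
    have /pred0P/(_ v) /= := tD _ _ vuD cD ne.
    by rewrite !inE eqxx /= => ->.
  move/setP/(_ u); rewrite Ew !inE eqxx orbT => /esym/orP[]/eqP // uv.
  move: (D2 _ vuD); rewrite uv setUid cards1 //.
rewrite -sum1_card.
transitivity (\sum_(w in A :\ v)
    #|[set D | perfect_matching A D && (([set v; w] \in D) && true)]|).
  under [RHS]eq_bigr => w _ do rewrite -sum1dep_card big_mkcondr /=.
  rewrite exchange_big /=; apply: eq_big => [D|D]; first by rewrite inE.
  rewrite inE => /step {1}<-; apply: eq_bigr => w _.
  by rewrite andbT; case: (_ \in _).
transitivity (\sum_(w in A :\ v) matching_number m).
  apply: eq_bigr => w; rewrite !inE => /andP[nwv wA].
  have sA : [set v; w] \subset A by rewrite subUset !sub1set vA wA.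
  have c2 : #|[set v; w]| = 2 by rewrite cards2 eq_sym nwv.
  rewrite card_matchings_through //.
  rewrite -(IH _ (card_setD_pair sA c2 Am)).
  by apply: eq_card => D; rewrite !inE andbT.
rewrite sum_nat_const; congr (_ * _).
by move: Am; rewrite (cardsD1 v) vA doubleS => -[].
Qed.

(** A matching that avoids the path w :: s either avoids {v, w} too or contains
    it. In the second case [w] is already used, so the only constraint left on
    the other chords is to avoid [s]. *)
Lemma card_avoiding_cons2 (T : finType) (A : {set T}) (v w : T) (s : seq T) :
  uniq [:: v, w & s] -> {subset [:: v, w & s] <= A} ->
  #|[set D | perfect_matching A D & avoids D [:: v, w & s]]| +
  #|[set D | perfect_matching (A :\: [set v; w]) D & avoids D s]| =
  #|[set D | perfect_matching A D & avoids D (w :: s)]|.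
Proof.
move=> us sA.
have vwA : [set v; w] \subset A.
  by rewrite subUset !sub1set !sA // !inE eqxx /= ?orbT.
have vw : v != w by move: us; rewrite /= inE; case: eqP.
have c2 : #|[set v; w]| = 2 by rewrite cards2 vw.
have E : #|[set D | perfect_matching (A :\: [set v; w]) D & avoids D s]| =
    #|[set D | perfect_matching A D &
        ([set v; w] \in D) && avoids D (w :: s)]|.
  rewrite card_matchings_through //; apply: eq_card => D; rewrite !inE.
  case pD: (perfect_matching _ _) => //=.
  have eqset x y : x != v -> x != w ->
      ([set x; y] \in [set v; w] |: D) = ([set x; y] \in D).
    move=> xv xw; rewrite !inE; case: eqP => //= /setP/(_ x).
    by rewrite !inE eqxx /= (negbTE xv) (negbTE xw).
  have nvs : v \notin s by move: us; rewrite /= inE negb_or; case: (v \in s); rewrite ?andbF.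
  have nws : w \notin s by move: us => /= /andP[_ /andP[]].
  rewrite /avoids; case: s nvs nws {us sA} => // u s nvs nws /=.
  have uv : u != v by move: nvs; rewrite inE negb_or eq_sym; case/andP.
  have uw : u != w by move: nws; rewrite inE negb_or eq_sym; case/andP.
  rewrite [[set w; u]]setUC eqset // [[set u; w]]setUC.
  rewrite (pair_notin_matchingD u pD) ?inE ?eqxx ?orbT //=.
  apply/esym/(@eq_in_path _ (fun x => x \in u :: s)); last by apply/allP.
  move=> x y xs ys; rewrite eqset //; first by apply: contraNneq nvs => <-.
  by apply: contraNneq nws => <-.
rewrite E -cardsUI -[RHS]addn0; congr (_ + _).
  apply: eq_card => D; rewrite !inE /avoids /=.
  case: (perfect_matching _ _); case: ([set v; w] \in D) => //=.
  by rewrite orbF.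
apply/eqP; rewrite cards_eq0; apply/eqP/setP=> D; rewrite !inE /avoids /=.
by case: ([set v; w] \in D); rewrite ?andbF.
Qed.

Local Open Scope ring_scope.

(** The inclusion-exclusion count: C(p - k, k) is the number of ways to choose
    k pairwise disjoint edges on a path of p vertices. *)
Definition avoiding_number (R : pzRingType) (m p : nat) : R :=
  \sum_(k < p.+1) (-1) ^+ k * ('C(p - k, k) * matching_number (m - k))%:R.

Lemma avoiding_number0 (R : pzRingType) (m : nat) :
  avoiding_number R m 0 = (matching_number m)%:R.
Proof.
by rewrite /avoiding_number big_ord_recl big_ord0 /= expr0 mul1r addr0 mul1n subn0.
Qed.

Lemma avoiding_number1 (R : pzRingType) (m : nat) :
  avoiding_number R m 1 = (matching_number m)%:R.
Proof.
rewrite /avoiding_number big_ord_recl big_ord1 /= expr0 mul1r mul1n subn0.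
by rewrite /bump /= mul0n mulr0 addr0.
Qed.

(** Pascal's rule, applied to each binomial coefficient. *)
Lemma avoiding_numberSS (R : pzRingType) (m p : nat) :
  avoiding_number R m.+1 p.+2 =
  avoiding_number R m.+1 p.+1 - avoiding_number R m p.
Proof.
rewrite /avoiding_number big_ord_recr /= subnn mul0n mulr0 addr0.
rewrite big_ord_recl [X in _ = X - _]big_ord_recl /= !expr0 !bin0 -addrA.
congr (_ + _); rewrite -sumrB; apply: eq_bigr => k _.
rewrite /bump /= add1n !subSS exprS.
have -> : (p.+1 - k = (p - k).+1)%N by have := ltn_ord k; lia.
by rewrite binS mulnDl natrD mulrDr !mulN1r !mulNr.
Qed.

(** Both sides satisfy the same recurrence, which shortens the path by one or
    two vertices. *)
Lemma card_avoiding (R : pzRingType) (T : finType) (A : {set T}) (m : nat)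
    (s : seq T) :
  #|A| = m.*2 -> uniq s -> {subset s <= A} ->
  #|[set D | perfect_matching A D & avoids D s]|%:R =
  avoiding_number R m (size s).
Proof.
have [k le_k] := ubnP (size s).
elim: k A m s le_k => // k IH A m [|v [|w s]] le_k Am us sA.
- rewrite avoiding_number0 -(card_matchings Am).
  by congr (_%:R); apply: eq_card => D; rewrite !inE andbT.
- rewrite avoiding_number1 -(card_matchings Am).
  by congr (_%:R); apply: eq_card => D; rewrite !inE andbT.
have vwA : [set v; w] \subset A.
  by rewrite subUset !sub1set !sA // !inE eqxx /= ?orbT.
have vw : v != w by move: us; rewrite /= inE; case: eqP.
have c2 : #|[set v; w]| = 2 by rewrite cards2 vw.
case: m Am => [|m] Am; first by move: (subset_leq_card vwA); rewrite c2 Am.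
have /= us1 : uniq (w :: s) by case/andP: us.
have us2 : uniq s by case/andP: us1.
rewrite avoiding_numberSS -(IH A m.+1 (w :: s)) //; first last.
  by move=> x xs; apply: sA; rewrite inE xs orbT.
rewrite -(IH (A :\: [set v; w]) m s) //; first last.
- move=> x xs; rewrite !inE sA ?inE ?xs ?orbT // andbT.
  by apply/norP; split; apply: contraTneq xs => ->; move: us => /=;
    rewrite inE; case: (v \in s); case: (w \in s); rewrite ?orbT ?andbF.
- exact: card_setD_pair.
- by move: le_k => /=; lia.
by rewrite -(card_avoiding_cons2 us sA) natrD addrK.
Qed.

Local Close Scope ring_scope.

(** * Bubbles as blocks of consecutive vertices *)

Definition block (m a p : nat) : {set 'I_m} := [set i : 'I_m | a <= i < a + p].

(** [pmap insub] lists the block in increasing order without a default vertex,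
    which ['I_m] may lack. *)
Definition block_seq (m a p : nat) : seq 'I_m := pmap insub (iota a p).

Lemma val_block_seq (m a p : nat) :
  a + p <= m -> [seq val i | i <- block_seq m a p] = iota a p.
Proof.
move=> apm; rewrite /block_seq pmap_filter; last by move=> k; exact: insubK.
apply/all_filterP/allP=> k; rewrite mem_iota => /andP[_ kap].
by rewrite /= isSome_insub; apply: leq_trans apm.
Qed.

Lemma size_block_seq (m a p : nat) :
  a + p <= m -> size (block_seq m a p) = p.
Proof. by move=> /val_block_seq/(congr1 size); rewrite size_map size_iota. Qed.

Lemma block_seq_uniq (m a p : nat) : uniq (block_seq m a p).
Proof. by apply: pmap_sub_uniq; exact: iota_uniq. Qed.

Lemma mem_block_seq (m a p : nat) (i : 'I_m) :
  (i \in block_seq m a p) = (a <= i < a + p).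
Proof. by rewrite mem_pmap_sub mem_iota. Qed.

Lemma card_block (m a p : nat) : a + p <= m -> #|block m a p| = p.
Proof.
move=> apm; rewrite -{2}(size_block_seq apm).
rewrite -(card_uniqP (block_seq_uniq m a p)).
by apply: eq_card => i; rewrite inE mem_block_seq.
Qed.

Lemma avoids_blockP (m a p : nat) (D : {set {set 'I_m}}) : a + p <= m ->
  reflect (forall i j : 'I_m,
      a <= i -> j = i.+1 :> nat -> j < a + p -> [set i; j] \notin D)
    (avoids D (block_seq m a p)).
Proof.
move=> apm; case: m D apm => [|m] D apm.
  have -> : block_seq 0 a p = [::] by case: (block_seq 0 a p) => [//|[]].
  by apply: ReflectT; case.
have nthE k : k < p -> nth ord0 (block_seq m.+1 a p) k = a + k :> nat.
  move=> kp; rewrite -(nth_map _ 0) ?size_block_seq //.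
  by rewrite val_block_seq // nth_iota.
apply: (iffP (sortedP ord0)); rewrite size_block_seq // => h.
  move=> i j ai ji jap; have := h (i - a).
  have -> : nth ord0 (block_seq m.+1 a p) (i - a) = i.
    by apply: val_inj; rewrite /= nthE; lia.
  have -> : nth ord0 (block_seq m.+1 a p) (i - a).+1 = j.
    by apply: val_inj; rewrite /= nthE; lia.
  by apply; lia.
by move=> k kp; apply: h; rewrite !nthE; lia.
Qed.

Lemma consecutive_block (m : nat) (A : {set 'I_m}) :
  A != set0 -> consecutive A ->
  exists2 a, a + #|A| <= m & A = block m a #|A|.
Proof.
case/set0Pn=> x xA cA.
case: (arg_minnP (fun i : 'I_m => val i) xA) => a aA amin.
case: (arg_maxnP (fun i : 'I_m => val i) xA) => b bA bmax.
have ab := amin b bA; have bm := ltn_ord b.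
have EA : A = block m a (b.+1 - a).
  apply/setP=> i; rewrite inE; apply/idP/idP=> [iA|iab].
    by have := amin i iA; have := bmax i iA; rewrite /=; lia.
  move/forall_inP/(_ a aA)/forall_inP/(_ b bA)/forallP/(_ i)/implyP: cA.
  by apply; move: ab iab => /=; lia.
have cardA : #|A| = b.+1 - a.
  by rewrite {1}EA card_block //; move: ab => /=; lia.
by exists a; rewrite cardA //; move: ab => /=; lia.
Qed.

Lemma short_endpointP (m : nat) (D : {set {set 'I_m}}) (v : 'I_m) :
  reflect (exists i j : 'I_m,
      [/\ j = i.+1 :> nat, [set i; j] \in D & (v == i) || (v == j)])
    (short_endpoint D v).
Proof.
apply: (iffP exists_inP) => [[c cD /andP[/existsP[i /existsP[j]]]]|[i [j [ji D_ij v_ij]]]].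
  case/andP=> /eqP ji /eqP Ec; rewrite {}Ec in cD *; rewrite !inE => v_ij.
  by exists i, j.
exists [set i; j] => //; rewrite !inE v_ij andbT.
by apply/existsP; exists i; apply/existsP; exists j; rewrite ji !eqxx.
Qed.

Lemma matching_short_eq (m : nat) (A : {set 'I_m}) (D : {set {set 'I_m}})
    (i j k l v : 'I_m) :
  perfect_matching A D -> j = i.+1 :> nat -> l = k.+1 :> nat ->
  [set i; j] \in D -> [set k; l] \in D ->
  (v == i) || (v == j) -> (v == k) || (v == l) -> i = k.
Proof.
case/andP=> /partition_trivIset/trivIsetP tD _ ji lk ijD klD vij vkl.
have: [set i; j] = [set k; l].
  apply/eqP; apply: contraTT vij => ne.
  have /pred0P/(_ v) /= := tD _ _ ijD klD ne.
  by rewrite !inE vkl andbT => ->.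
move/setP=> E; have := E i; have := E j.
rewrite !inE !eqxx orbT /= => /esym/orP h1 /esym/orP h2.
apply: val_inj => /=.
by case: h1 => /eqP/(congr1 val) /= h1; case: h2 => /eqP/(congr1 val) /= h2; lia.
Qed.

(** Maximality forces the vertex just outside the block, if there is one, to be
    an endpoint of a short chord; as no vertex of the block is such an endpoint,
    that chord points away from the block. Conversely such a flanking chord
    occupies the outer neighbour, so it both blocks any extension and keeps the
    end vertex of the block from being matched to that neighbour. *)
Lemma bubble_blockP (m a p : nat) (D : {set {set 'I_m}}) :
  perfect_matching [set: 'I_m] D -> 0 < p -> a + p <= m ->
  reflect
    [/\ avoids D (block_seq m a p),
        a = 0 \/ exists i j : 'I_m,
          [/\ j = i.+1 :> nat, a = j.+1 & [set i; j] \in D] &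
        a + p = m \/ exists i j : 'I_m,
          [/\ i = a + p :> nat, j = i.+1 :> nat & [set i; j] \in D]]
    (bubble D (block m a p)).
Proof.
move=> mD p0 apm; apply: (iffP andP) => [[_ /maxsetP[]]|].
  case/andP=> _ /forall_inP free maxI.
  have short_out (i j : 'I_m) : j = i.+1 :> nat -> [set i; j] \in D ->
      (~~ (a <= i < a + p)) && (~~ (a <= j < a + p)).
    move=> ji ijD; apply/andP; split; apply/negP=> h.
      move: (free i); rewrite inE => /(_ h)/negP; apply; apply/short_endpointP.
      by exists i, j; rewrite eqxx.
    move: (free j); rewrite inE => /(_ h)/negP; apply; apply/short_endpointP.
    by exists i, j; rewrite eqxx orbT.
  (* By maximality, a vertex that extends the block must be a short endpoint. *)
  have grow (v : 'I_m) : consecutive (v |: block m a p) ->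
      v \notin block m a p -> short_endpoint D v.
    move=> cv; apply: contraR => ev; rewrite -(maxI (v |: block m a p)).
    - by rewrite setU11.
    - rewrite cv; apply/forall_inP=> w /setU1P[->//|]; exact: free.
    - exact: subsetUr.
  split.
  - apply/(avoids_blockP _ apm) => i j ai ji jap; apply/negP=> /(short_out _ _ ji).
    lia.
  - case: a => [|a] in apm free maxI short_out grow *; [by left|right].
    have am : a < m by lia.
    have /short_endpointP[i [j [ji ijD]]] : short_endpoint D (Ordinal am).
      apply: grow; last by rewrite inE /=; lia.
      apply/forall_inP=> i /[!inE] i_in; apply/forall_inP=> k /[!inE] k_in.
      apply/forallP=> j; rewrite !inE; apply/implyP.
      by rewrite -!val_eqE /= in i_in k_in *; lia.
    rewrite -!val_eqE /= => v_ij; exists i, j; split=> //.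
    by have := short_out _ _ ji ijD; lia.
  - have [->|ne] := eqVneq (a + p) m; [by left|right].
    have bm : a + p < m by lia.
    have /short_endpointP[i [j [ji ijD]]] : short_endpoint D (Ordinal bm).
      apply: grow; last by rewrite inE /=; lia.
      apply/forall_inP=> i /[!inE] i_in; apply/forall_inP=> k /[!inE] k_in.
      apply/forallP=> j; rewrite !inE; apply/implyP.
      by rewrite -!val_eqE /= in i_in k_in *; lia.
    rewrite -!val_eqE /= => v_ij; exists i, j; split=> //.
    by have := short_out _ _ ji ijD; lia.
case=> /(avoids_blockP _ apm) no_short left_end right_end; split.
  by rewrite -card_gt0 card_block.
have left_short (v : 'I_m) : v.+1 = a -> short_endpoint D v.
  case: left_end => [->//|[i [j [ji aj ijD]]] va].
  apply/short_endpointP; exists i, j; split=> //.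
  by rewrite -!val_eqE /=; lia.
have right_short (v : 'I_m) : v = a + p :> nat -> short_endpoint D v.
  move=> va; case: right_end => [am|[i [j [ia ji ijD]]]].
    by have := ltn_ord v; lia.
  apply/short_endpointP; exists i, j; split=> //.
  by rewrite -!val_eqE /=; lia.
apply/maxsetP; split=> [|S].
  apply/andP; split.
    apply/forall_inP=> i /[!inE] i_in; apply/forall_inP=> k /[!inE] k_in.
    by apply/forallP=> j; rewrite !inE; apply/implyP; lia.
  apply/forall_inP=> v; rewrite inE => v_in.
  apply/negP=> /short_endpointP[i [j [ji ijD v_ij]]].
  have [jap|jap] := ltnP j (a + p); last first.
    case: right_end => [am|[k [l [ka lk klD]]]]; first by have := ltn_ord j; lia.
    have jk : j = k by apply: val_inj; rewrite -!val_eqE /= in v_ij *; lia.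
    have := @matching_short_eq _ _ _ i j k l j mD ji lk ijD klD.
    by rewrite jk !eqxx orbT => /(_ isT isT)/(congr1 val) /=; rewrite -jk; lia.
  have [ai|ai] := leqP a i; first by have := no_short i j ai ji jap; rewrite ijD.
  case: left_end => [a0|[k [l [lk al klD]]]]; first by lia.
  have il : i = l by apply: val_inj; rewrite -!val_eqE /= in v_ij *; lia.
  have := @matching_short_eq _ _ _ i j k l i mD ji lk ijD klD.
  by rewrite il !eqxx orbT => /(_ isT isT)/(congr1 val) /=; lia.
case/andP=> cS /forall_inP freeS sIS; apply/eqP; rewrite eqEsubset sIS andbT.
have am : a < m by lia.
have bm : a + p.-1 < m by lia.
have aS : Ordinal am \in S by apply: (subsetP sIS); rewrite inE /=; lia.
have bS : Ordinal bm \in S by apply: (subsetP sIS); rewrite inE /=; lia.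
apply/subsetP=> j jS; rewrite inE; apply/andP; split; rewrite leqNgt; apply/negP=> ja.
  have a1m : a.-1 < m by lia.
  have : Ordinal a1m \in S.
    move/forall_inP/(_ j jS)/forall_inP/(_ _ aS)/forallP/(_ (Ordinal a1m)): cS.
    by move/implyP; apply=> /=; lia.
  by move/freeS/negP; apply; apply: left_short => /=; lia.
have b1m : a + p < m by have := ltn_ord j; lia.
have : Ordinal b1m \in S.
  move/forall_inP/(_ _ bS)/forall_inP/(_ _ jS)/forallP/(_ (Ordinal b1m)): cS.
  by move/implyP; apply=> /=; lia.
by move/freeS/negP; apply; apply: right_short.
Qed.

(** * Counting bubbles *)

Lemma block2E (m : nat) (i j : 'I_m) :
  j = i.+1 :> nat -> block m i 2 = [set i; j].
Proof. by move=> ji; apply/setP=> k; rewrite !inE -!val_eqE /=; lia. Qed.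

(** At the right end of the diagram [block m k 2] is truncated to at most one
    vertex and is not a chord: membership in a matching implies that it fits. *)
Lemma block2_in_matching (m k : nat) (A : {set 'I_m}) (D : {set {set 'I_m}}) :
  perfect_matching A D ->
  reflect (exists i j : 'I_m,
      [/\ i = k :> nat, j = i.+1 :> nat & [set i; j] \in D])
    (block m k 2 \in D).
Proof.
case/andP=> _ /forall_inP D2; apply: (iffP idP) => [kD|[i [j [<- ji]]]].
  have /cards2P[x [y [xy Ek]]] := D2 _ kD.
  have k1m : k.+1 < m.
    have /setP Ek' := Ek; have := Ek' x; have := Ek' y; rewrite !inE !eqxx orbT /=.
    by have := ltn_ord x; have := ltn_ord y; move: xy; rewrite -val_eqE /=; lia.
  exists (Ordinal (ltnW k1m)), (Ordinal k1m); split=> //.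
  by rewrite -block2E.
by rewrite (block2E ji).
Qed.

Lemma bubble_blockE (m a p : nat) (D : {set {set 'I_m}}) :
  perfect_matching [set: 'I_m] D -> 0 < p -> a + p <= m ->
  bubble D (block m a p) =
  [&& avoids D (block_seq m a p),
      (a == 0) || (1 < a) && (block m (a - 2) 2 \in D) &
      (a + p == m) || (block m (a + p) 2 \in D)].
Proof.
move=> mD p0 apm; apply/(bubble_blockP mD p0 apm)/and3P.
  case=> -> left_end right_end; split=> //.
    case: left_end => [->//|[i [j [ji aj ijD]]]].
    rewrite aj ji /=; apply/(block2_in_matching _ mD).
    by exists i, j; split=> //; lia.
  case: right_end => [->|h]; first by rewrite eqxx.
  by apply/orP; right; apply/(block2_in_matching _ mD).
case=> -> left_end right_end; split=> //.
  case/orP: left_end => [/eqP|/andP[a1]]; first by left.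
  case/(block2_in_matching _ mD)=> i [j [ia ji ijD]].
  by right; exists i, j; split=> //; lia.
case/orP: right_end => [/eqP|]; first by left.
by move/(block2_in_matching _ mD); right.
Qed.

Lemma block_inj (m a b p : nat) : 0 < p -> a + p <= m -> b + p <= m ->
  block m a p = block m b p -> a = b.
Proof.
move=> p0 am bm /setP E.
have am' : a < m by lia.
have bm' : b < m by lia.
have := E (Ordinal am'); have := E (Ordinal bm'); rewrite !inE /=; lia.
Qed.

(** A bubble is an interval, so it is determined by its first vertex; then
    exchange the sums over diagrams and over positions. *)
Lemma bubble_countE (n p : nat) : 0 < p -> p <= 2 * n ->
  bubble_count n p =
  \sum_(a < (2 * n - p).+1)
    #|[set D | perfect_matching [set: 'I_(2 * n)] D &
               bubble D (block (2 * n) a p)]|.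
Proof.
move=> p0 pn.
under [RHS]eq_bigr => a _ do rewrite -sum1dep_card big_mkcondr /=.
rewrite exchange_big /=; apply: eq_bigr => D _.
rewrite -big_mkcond /= sum1dep_card.
have le_a (a : 'I_(2 * n - p).+1) : a + p <= 2 * n by have := ltn_ord a; lia.
have inj : injective (fun a : 'I_(2 * n - p).+1 => block (2 * n) a p).
  by move=> a b E; apply: val_inj; apply: block_inj E.
rewrite -(card_imset _ inj); apply: eq_card => A; rewrite inE.
apply/andP/imsetP=> [[bA /eqP Ap]|[a]]; last first.
  by rewrite inE => ba ->; rewrite ba card_block ?eqxx.
have [A0 cA] : A != set0 /\ consecutive A.
  by case/andP: bA => -> /maxsetP[/andP[]].
have [a] := consecutive_block A0 cA; rewrite Ap => apm EA.
have ap : a < (2 * n - p).+1 by lia.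
by exists (Ordinal ap); rewrite ?inE -?EA.
Qed.

Lemma avoids_setU1 (T : finType) (c : {set T}) (D : {set {set T}}) (s : seq T) :
  {in s, forall x, x \notin c} -> avoids (c |: D) s = avoids D s.
Proof.
move=> sc; apply: (@eq_in_sorted _ (fun x => x \in s)); last by apply/allP.
move=> x y xs _; rewrite !inE; case: eqP => //= E.
by have := sc x xs; rewrite -E !inE eqxx.
Qed.

Lemma block_seq_out (m a p b q : nat) :
  (b + q <= a) || (a + p <= b) ->
  {in block_seq m a p, forall i, i \notin block m b q}.
Proof. by move=> h i; rewrite mem_block_seq inE; lia. Qed.

(** Forcing one chord away from the block removes two points and leaves the
    path condition unchanged. *)
Lemma card_avoiding_with_chord (R : pzRingType) (n a p b : nat) :
  0 < p -> a + p <= 2 * n.+1 -> b + 2 <= 2 * n.+1 ->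
  (b + 2 <= a) || (a + p <= b) ->
  (#|[set D | perfect_matching [set: 'I_(2 * n.+1)] D &
       (block (2 * n.+1) b 2 \in D) &&
       avoids D (block_seq (2 * n.+1) a p)]|%:R =
  avoiding_number R n p)%R.
Proof.
move=> p0 apm bm ab.
have c2 := card_block bm.
rewrite card_matchings_through ?subsetT //.
rewrite -{2}(size_block_seq apm).
rewrite -(card_avoiding R (A := [set: _] :\: block (2 * n.+1) b 2)).
- congr (_%:R)%R; apply: eq_card => D; rewrite !inE avoids_setU1 //.
  exact: block_seq_out.
- by apply: card_setD_pair => //; rewrite cardsT card_ord mul2n.
- exact: block_seq_uniq.
by move=> i is_; rewrite !inE andbT; have := block_seq_out ab is_; rewrite inE.
Qed.

Lemma card_bubble_left (R : pzRingType) (n p : nat) :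
  0 < p -> p + 2 <= 2 * n.+1 ->
  (#|[set D | perfect_matching [set: 'I_(2 * n.+1)] D &
             bubble D (block (2 * n.+1) 0 p)]|%:R =
  avoiding_number R n p)%R.
Proof.
move=> p0 pm.
rewrite -(card_avoiding_with_chord (a := 0) (b := p) R p0) ?leqnn ?orbT //; last by lia.
congr (_%:R)%R; apply: eq_card => D; rewrite !inE.
case mD: (perfect_matching _ _) => //=.
rewrite bubble_blockE //=; last by lia.
by rewrite add0n ltn_eqF; [rewrite andbC | lia].
Qed.

Lemma card_bubble_right (R : pzRingType) (n a p : nat) :
  0 < p -> 1 < a -> a + p = 2 * n.+1 ->
  (#|[set D | perfect_matching [set: 'I_(2 * n.+1)] D &
             bubble D (block (2 * n.+1) a p)]|%:R =
  avoiding_number R n p)%R.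
Proof.
move=> p0 a1 apm.
rewrite -(card_avoiding_with_chord (a := a) (b := a - 2) R p0); try lia.
congr (_%:R)%R; apply: eq_card => D; rewrite !inE.
case mD: (perfect_matching _ _) => //=.
rewrite bubble_blockE //=; last by lia.
by rewrite apm eqxx a1 andbT gtn_eqF; [rewrite andbC | lia].
Qed.

Lemma card_bubble_inside (R : pzRingType) (n a p : nat) :
  0 < p -> 1 < a -> a + p + 2 <= 2 * n.+2 ->
  (#|[set D | perfect_matching [set: 'I_(2 * n.+2)] D &
             bubble D (block (2 * n.+2) a p)]|%:R =
  avoiding_number R n p)%R.
Proof.
move=> p0 a1 apm; set m := 2 * n.+2 in apm *.
have am : a + p <= m by lia.
have le1 : a - 2 + 2 <= m by lia.
pose c := block m (a - 2) 2; pose d := block m (a + p) 2.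
have c2 : #|c| = 2 by apply: card_block.
have d2 : #|d| = 2 by apply: card_block.
have nc : {in block_seq m a p, forall i, i \notin c}.
  by apply: block_seq_out; lia.
have nd : {in block_seq m a p, forall i, i \notin d}.
  by apply: block_seq_out; lia.
have cd : {in d, forall i, i \notin c} by move=> i; rewrite !inE; lia.
have dc : d != c.
  apply/eqP=> E; have : d != set0 by rewrite -card_gt0 d2.
  by case/set0Pn=> i i_d; have := cd i i_d; rewrite -E i_d.
have sd : d \subset [set: 'I_m] :\: c.
  by apply/subsetP=> i /cd ic; rewrite in_setD in_setT ic.
transitivity ((#|[set D | perfect_matching [set: 'I_m] D &
    (c \in D) && ((d \in D) && avoids D (block_seq m a p))]|%:R)%R : R).
  congr (_%:R)%R; apply: eq_card => D; rewrite !inE.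
  case mD: (perfect_matching _ _) => //=.
  have a0 : (a == 0) = false by lia.
  have apF : (a + p == m) = false by lia.
  rewrite bubble_blockE //= a1 a0 apF /=.
  by rewrite andbC -andbA.
have /= -> := card_matchings_through
  (fun D => (d \in D) && avoids D (block_seq m a p)) (subsetT c) c2.
have E : [set D | perfect_matching ([set: 'I_m] :\: c) D &
      (d \in c |: D) && avoids (c |: D) (block_seq m a p)] =
    [set D | perfect_matching ([set: 'I_m] :\: c) D &
      (d \in D) && avoids D (block_seq m a p)].
  by apply/setP=> D; rewrite !inE avoids_setU1 // (negbTE dc).
rewrite E card_matchings_through // -{2}(size_block_seq am).
rewrite -(card_avoiding R (A := ([set: _] :\: c) :\: d)).
- by congr (_%:R)%R; apply: eq_card => D; rewrite !inE avoids_setU1.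
- apply: card_setD_pair => //; apply: card_setD_pair; rewrite ?subsetT //.
  by rewrite cardsT card_ord /m mul2n.
- exact: block_seq_uniq.
by move=> i i_s; rewrite !in_setD in_setT nc ?nd.
Qed.

(** At distance one from an end there is no room for a flanking short chord. *)
Lemma card_bubble_off (m a p : nat) :
  0 < p -> a + p <= m -> (a == 1) || (a + p == m.-1) ->
  #|[set D | perfect_matching [set: 'I_m] D & bubble D (block m a p)]| = 0.
Proof.
move=> p0 apm off; apply/eqP; rewrite cards_eq0; apply/eqP/setP=> D.
rewrite !inE; case mD: (perfect_matching _ _) => //=.
rewrite bubble_blockE //; case/orP: off => /eqP ap.
  by rewrite ap /= andbF.
have -> : (a + p == m) = false by lia.
apply/negP=> /and3P[_ _ /(block2_in_matching _ mD)[i [j [ia ji _]]]].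
by have := ltn_ord j; lia.
Qed.

Local Open Scope ring_scope.

(** The natural subtraction [2 * n + 1 - p] is intended: for p = 2n + 2 there is
    no inner block, and the count of inner positions is 0. *)
Lemma bubble_count_avoiding (R : pzRingType) (n p : nat) :
  (0 < p)%N -> (p <= 2 * n.+1)%N ->
  (bubble_count n.+2 p)%:R =
  avoiding_number R n.+1 p *+ 2 + avoiding_number R n p *+ (2 * n + 1 - p).
Proof.
move=> p0 pn; rewrite bubble_countE //; last by lia.
rewrite natr_sum.
have [L EL] : exists L, (2 * n.+2 - p = L.+2)%N by exists (2 * n.+1 - p)%N; lia.
have p_L : (L.+2 + p = 2 * n.+2)%N by lia.
(* Separate the two end positions from the others. *)
rewrite EL big_ord_recl big_ord_recr /= card_bubble_left //; last by lia.
rewrite card_bubble_right; try by rewrite /bump /=; lia.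
rewrite addrA addrAC -mulr2n; congr (_ + _).
case: L => [|L] in EL p_L *.
  rewrite big_ord1 card_bubble_off /bump //=; try lia.
  by have -> : (2 * n + 1 - p = 0)%N by lia.
(* The positions at distance one from an end contribute nothing. *)
rewrite big_ord_recl big_ord_recr /= !card_bubble_off; try by rewrite /bump /=; lia.
rewrite add0r addr0; have -> : (2 * n + 1 - p = L)%N by lia.
rewrite -[L in _ *+ L]card_ord -sumr_const; apply: eq_bigr => k _.
by apply: card_bubble_inside; have := ltn_ord k; rewrite /bump /=; lia.
Qed.

(** Telescoping: each term is a difference of two consecutive avoiding numbers,
    one size up. *)
Lemma sum_avoiding_number (R : pzRingType) (m q : nat) :
  \sum_(p < q) avoiding_number R m p =
  (matching_number m.+1)%:R - avoiding_number R m.+1 q.+1.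
Proof.
elim: q => [|q IH]; first by rewrite big_ord0 avoiding_number1 subrr.
by rewrite big_ord_recr /= IH avoiding_numberSS opprB -addrA [- _ + _]addrC.
Qed.

(** Summation by parts: increasing [q] by one adds a plain sum of avoiding
    numbers, so the telescoping identity applies twice. *)
Lemma weighted_sum_avoiding_number (R : comNzRingType) (m q : nat) :
  \sum_(p < q) avoiding_number R m p *+ (q - p) =
  (matching_number m.+1)%:R *+ q.+2 - (matching_number m.+2)%:R
  + avoiding_number R m.+2 q.+3.
Proof.
elim: q => [|q IH].
  rewrite big_ord0 !avoiding_numberSS !avoiding_number1 avoiding_number0.
  by rewrite mulr2n; ring.
have -> : \sum_(p < q.+1) avoiding_number R m p *+ (q.+1 - p) =
    \sum_(p < q) avoiding_number R m p *+ (q - p) +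
    \sum_(p < q.+1) avoiding_number R m p.
  rewrite !big_ord_recr /= subSnn mulr1n addrA -big_split /=; congr (_ + _); apply: eq_bigr => p _.
  by rewrite subSn 1?ltnW // mulrSr.
rewrite IH sum_avoiding_number mulrSr [avoiding_number R m.+2 q.+4]avoiding_numberSS.
by ring.
Qed.

(** Both sums over p are extended to p = 0 to telescope. In the inner-block sum
    the product (2n + 3) (2n + 1)!! is the next matching number, so that
    everything cancels except one avoiding number. *)
Lemma sum_bubble_count (R : comNzRingType) (n : nat) :
  (\sum_(1 <= p < (2 * n.+2 - 2).+1) bubble_count n.+2 p)%:R =
  (matching_number n.+2)%:R *+ 2 - avoiding_number R n.+2 (2 * n.+2)
  - (matching_number n.+1)%:R *+ 3.
Proof.
have -> : (2 * n.+2 - 2 = (2 * n).+2)%N by lia.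
rewrite natr_sum.
transitivity (\sum_(1 <= p < (2 * n).+3)
    (avoiding_number R n.+1 p *+ 2 + avoiding_number R n p *+ (2 * n + 1 - p))).
  rewrite big_nat [RHS]big_nat; apply: eq_bigr => p /andP[p1 pn].
  by apply: bubble_count_avoiding; lia.
pose f p : R := avoiding_number R n.+1 p *+ 2 +
  avoiding_number R n p *+ (2 * n + 1 - p).
rewrite -[LHS]/(\sum_(1 <= p < (2 * n).+3) f p).
have -> : \sum_(1 <= p < (2 * n).+3) f p = \sum_(p < (2 * n).+3) f p - f 0%N.
  by rewrite -(big_mkord xpredT f) big_ltn // addrC addKr.
rewrite /f big_split [LHS]/= sumrMnl sum_avoiding_number.
have -> : \sum_(p < (2 * n).+3) avoiding_number R n p *+ (2 * n + 1 - p) =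
    avoiding_number R n.+2 (2 * n).+4.
  rewrite 2!big_ord_recr /= addn1 subnn.
  have -> : ((2 * n).+1 - (2 * n).+2 = 0)%N by lia.
  rewrite !mulr0n !addr0 weighted_sum_avoiding_number [matching_number n.+2]/=.
  have -> : (2 * n).+3 = n.+1.*2.+1 by lia.
  by rewrite natrM mulr_natl subrr add0r.
have -> : (2 * n.+2)%N = (2 * n).+4 by lia.
rewrite !avoiding_number0 subn0 addn1.
have -> : (matching_number n)%:R *+ (2 * n).+1 = (matching_number n.+1)%:R :> R.
  by rewrite /= -mul2n natrM mulr_natl.
by ring.
Qed.

(** * Asymptotics of the avoiding numbers *)

From mathcomp Require Import all_classical all_reals all_analysis.
Import numFieldNormedType.Exports.
Local Open Scope classical_set_scope.

(** Dominated convergence for series: the tail beyond a fixed [K] is uniformly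
    small by domination, and the first [K] terms converge one by one. *)
Lemma tannery (R : realType) (f : nat -> nat -> R) (g M : nat -> R)
    (N : nat -> nat) (l : R) :
  (forall k, f n k @[n --> \oo] --> g k) ->
  (forall n k, `|f n k| <= M k) ->
  (forall n k, (N n <= k)%N -> f n k = 0) ->
  cvgn (series M) -> series g @ \oo --> l ->
  (fun n => \sum_(k < N n) f n k) @ \oo --> l.
Proof.
move=> fg fM fN cM gl; apply/cvgrPdist_le => e e0.
have e3 : 0 < e / 3 by lra.
have M0 k : 0 <= M k by apply: le_trans (fM 0%N k).
have partial K : (fun n => series (f n) K) @ \oo --> series g K.
  elim: K => [|K IH].
    rewrite seriesEnat /= big_geq //.
    by under eq_fun do rewrite seriesEnat /= big_geq //; exact: cvg_cst.
  by under eq_fun do rewrite seriesSr; rewrite seriesSr; exact: cvgD.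
have /cvgrPdist_le/(_ _ e3)[K1 _ gK] := gl.
have /cvgrPdist_le/(_ _ e3)[K2 _ MK] := cM.
(* From K on, both the tail of M and the error of g are below e / 3. *)
pose K := maxn K1 K2.
have gK' : `|l - series g K| <= e / 3 by apply: gK; rewrite /= leq_maxl.
have MK' : lim (series M @ \oo) - series M K <= e / 3.
  by apply: le_trans (ler_norm _) (MK _ _); rewrite /= leq_maxr.
have tail n Q : (K <= Q)%N -> `|series (f n) Q - series (f n) K| <= e / 3.
  move=> KQ; rewrite sub_series_geq //.
  apply: le_trans (ler_norm_sum _ _ _) _.
  apply: le_trans (ler_sum _ (fun k _ => fM n k)) _.
  rewrite -sub_series_geq //; apply: le_trans MK'.
  rewrite lerD2r; apply: nondecreasing_cvgn_le => //.
  by apply: nondecreasing_series => k _ _; exact: M0.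
have /cvgrPdist_le/(_ _ e3) := partial K; apply: filterS => n /= near_n.
have -> : \sum_(k < N n) f n k = series (f n) (maxn K (N n)).
  rewrite seriesEnat /= (big_cat_nat (n := N n)) ?leq_maxr //=.
  rewrite big_mkord [X in _ + X]big_nat [X in _ + X]big1 ?addr0 //.
  by move=> k /andP[/fN].
have := tail n (maxn K (N n)) (leq_maxl _ _).
rewrite distrC => tail_n.
rewrite (_ : l - _ = (l - series g K) + (series g K - series (f n) K) +
  (series (f n) K - series (f n) (maxn K (N n)))); last by ring.
apply: le_trans (ler_normD _ _) _; apply: le_trans (lerD (ler_normD _ _) (lexx _)) _.
lra.
Qed.

Lemma cvg_div_nat (R : realType) (a : nat -> R) (s C : R) :
  (forall n, `|a n - s * n%:R| <= C) -> (fun n => a n / n%:R) @ \oo --> s.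
Proof.
move=> aC; have invn : (fun n => n%:R^-1 : R) @ \oo --> 0.
  apply/(gtr0_cvgV0 (f := fun n => n%:R : R)); last exact: cvgr_idn.
  by exists 1%N => // n /= n1; rewrite ltr0n.
apply/cvgrPdist_le => e e0.
have : (fun n => C * n%:R^-1 : R) @ \oo --> C * 0 by apply: cvgM invn; exact: cvg_cst.
rewrite mulr0 => /cvgrPdist_le/(_ e e0) h; near=> n.
have n0 : (0 < n%:R :> R) by rewrite ltr0n; near: n; exact: nbhs_infty_gt.
have : `|0 - C / n%:R| <= e by near: n.
rewrite sub0r normrN; apply: le_trans.
have -> : s - a n / n%:R = - (a n - s * n%:R) / n%:R by field; lra.
rewrite normrM normrN [leRHS]normrM ler_wpM2r //.
exact: le_trans (aC n) (ler_norm _).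
Unshelve. all: by end_near. Qed.

(** Only the leading linear terms matter in a quotient of two sequences that are
    linear up to a bounded error. *)
Lemma cvg_quotient (R : realType) (a b : nat -> R) (s t C C' : R) :
  (forall n, `|a n - s * n%:R| <= C) -> (forall n, `|b n - t * n%:R| <= C') ->
  t != 0 -> (fun n => a n / b n) @ \oo --> s / t.
Proof.
move=> aC bC t0.
have ab : (fun n => (a n / n%:R) * (b n / n%:R)^-1) @ \oo --> s / t.
  by apply: cvgM; [exact: cvg_div_nat aC | apply: cvgV => //;
    exact: cvg_div_nat bC].
apply: (cvg_trans _ ab); apply: near_eq_cvg; near=> n => /=.
have n0 : n%:R != 0 :> R.
  by rewrite pnatr_eq0 -lt0n; near: n; exact: nbhs_infty_gt.
by rewrite invfM invrK mulrACA mulVf // mulr1.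
Unshelve. all: by end_near. Qed.

Lemma matching_number_gt0 (m : nat) : (0 < matching_number m)%N.
Proof. by elim: m => //= m IH; rewrite muln_gt0. Qed.

Lemma matching_number_prod (m k : nat) : (k <= m)%N ->
  (matching_number m = (\prod_(j < k) (m - j).*2.-1) * matching_number (m - k))%N.
Proof.
elim: k => [|k IH] km; first by rewrite big_ord0 mul1n subn0.
rewrite (IH (ltnW km)) big_ord_recr /= -mulnA; congr (_ * _)%N.
by have -> : (m - k = (m - k.+1).+1)%N by lia.
Qed.

(** Written as a product of [k] ratios, each term has both an evident limit and an
    evident bound. *)
Lemma avoiding_term_prod (R : realType) (m p k : nat) : (k <= m)%N ->
  (-1) ^+ k * ('C(p - k, k) * matching_number (m - k))%:R
    / (matching_number m)%:R =
  (-1) ^+ k / k`!%:R *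
    \prod_(j < k) ((p - k - j)%:R / (m - j).*2.-1%:R) :> R.
Proof.
move=> km; rewrite (matching_number_prod km) big_split /= prodfV.
rewrite -!natr_prod -ffact_prod -bin_ffact !natrM invfM.
have k0 : k`!%:R != 0 :> R by rewrite pnatr_eq0 -lt0n fact_gt0.
have m0 : (matching_number (m - k))%:R != 0 :> R.
  by rewrite pnatr_eq0 -lt0n matching_number_gt0.
set P := _^-1; by field; rewrite k0 m0.
Qed.

(** If the binomial coefficient is nonzero then 2k <= p <= 2m, and for j < k the
    ratio (p - k - j) / (2m - 2j - 1) is at most 1 because k >= j + 1. *)
Lemma avoiding_term_le (R : realType) (m p k : nat) : (p <= 2 * m)%N ->
  `|(-1) ^+ k * ('C(p - k, k) * matching_number (m - k))%:R
     / (matching_number m)%:R| <= exp_coeff 1 k :> R.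
Proof.
move=> pm; rewrite /exp_coeff /= expr1n div1r.
have [kp|kp] := ltnP (p - k) k.
  by rewrite bin_small // mul0n mulr0 mul0r normr0 invr_ge0.
rewrite avoiding_term_prod; last by lia.
rewrite !normrM normrX normrN1 expr1n mul1r.
rewrite ger0_norm ?invr_ge0 // ler_piMr ?invr_ge0 // normr_prod.
apply: prodr_ile1 => j _; rewrite normr_ge0 ger0_norm ?divr_ge0 //=.
have jk := ltn_ord j.
by rewrite ler_pdivrMr ?mul1r ?ler_nat ?ltr0n; lia.
Qed.

(** Each of the [k] factors of the k-th term tends to x / 2, so the limit is the
    exponential series at - x / 2, and the bound 1 / k! is summable. *)
Lemma cvg_avoiding_ratio (R : realType) (p : nat -> nat) (x C : R) :
  (forall m, (p m <= 2 * m)%N) ->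
  (forall m, `|(p m)%:R - x * m%:R| <= C) ->
  (fun m => avoiding_number R m (p m) / (matching_number m)%:R) @ \oo -->
  expR (- (x / 2)).
Proof.
move=> pm pC.
pose f m k : R := (-1) ^+ k *
  ('C(p m - k, k) * matching_number (m - k))%:R / (matching_number m)%:R.
have -> : (fun m => avoiding_number R m (p m) / (matching_number m)%:R) =
    (fun m => \sum_(k < (p m).+1) f m k).
  by apply/funext=> m; rewrite /avoiding_number mulr_suml.
apply: (@tannery _ f (exp_coeff (- (x / 2))) (exp_coeff 1)).
- move=> k; pose h j m : R := (p m - k - j)%:R / (m - j).*2.-1%:R.
  have hx j : h j @ \oo --> x / 2.
    apply: (@cvg_quotient _ _ _ _ _ (C + (k + j)%:R) (2 * j.+1)%:R).
    + move=> m; rewrite -subnDA.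
      have -> : (p m - (k + j))%:R = (p m)%:R - (minn (p m) (k + j))%:R :> R.
        by rewrite -natrB ?geq_minl //; congr (_%:R); lia.
      rewrite addrAC; apply: le_trans (ler_normB _ _) _; apply: lerD => //.
      by rewrite ger0_norm // ler_nat geq_minr.
    + move=> m.
      have -> : (m - j).*2.-1%:R = 2 * m%:R - (minn (2 * m) (2 * j).+1)%:R :> R.
        by rewrite -natrM -natrB ?geq_minl //; congr (_%:R); lia.
      rewrite addrAC subrr sub0r normrN ger0_norm // ler_nat.
      by lia.
    + by rewrite pnatr_eq0.
  have prodx i : (fun m => \prod_(j < i) h j m) @ \oo --> (x / 2) ^+ i.
    elim: i => [|i IH].
      by under eq_fun do rewrite big_ord0; exact: cvg_cst.
    under eq_fun do rewrite big_ord_recr /=.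
    by rewrite exprSr; apply: cvgM.
  have -> : exp_coeff (- (x / 2)) k = (-1) ^+ k / k`!%:R * (x / 2) ^+ k.
    by rewrite /exp_coeff /= [(- (x / 2)) ^+ k]exprNn mulrAC.
  have lim_f : (fun m => (-1) ^+ k / k`!%:R * \prod_(j < k) h j m) @ \oo -->
      (-1) ^+ k / k`!%:R * (x / 2) ^+ k.
    by apply: cvgM; [exact: cvg_cst|].
  apply: (cvg_trans _ lim_f); apply: near_eq_cvg; near=> m.
  by rewrite /f avoiding_term_prod //; near: m; exact: nbhs_infty_ge.
- by move=> m k; apply: avoiding_term_le.
- by move=> m k km; rewrite /f bin_small ?mul0n ?mulr0 ?mul0r //; lia.
- exact: is_cvg_series_exp_coeff.
- exact: is_cvg_series_exp_coeff.
Unshelve. all: by end_near. Qed.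

(** * The limit law *)

(** The quotient of the theorem with numerator and denominator divided by
    the number of diagrams. The [minn] is harmless, because
    the coefficient vanishes when p > 2N; it makes the avoiding ratio fall in
    the range p <= 2m of [cvg_avoiding_ratio] also for x = 2. *)
Lemma bubble_ratioE (R : realFieldType) (N p : nat) :
  (0 < p)%N -> (p <= 2 * N.+1)%N ->
  N.+1%:R * (bubble_count N.+2 p)%:R
    / (\sum_(1 <= q < (2 * N.+2 - 2).+1) bubble_count N.+2 q)%:R =
  ((2 * N.+1)%:R / (2 * N + 3)%:R
     * (avoiding_number R N.+1 p / (matching_number N.+1)%:R) +
   N.+1%:R / (2 * N + 3)%:R * ((2 * N + 1 - p)%:R / (2 * N + 1)%:R)
     * (avoiding_number R N (minn p (2 * N)) / (matching_number N)%:R))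
  / (2 - avoiding_number R N.+2 (2 * N.+2) / (matching_number N.+2)%:R
     - 3 / (2 * N + 3)%:R).
Proof.
move=> p0 pN; rewrite sum_bubble_count bubble_count_avoiding //.
have -> : avoiding_number R N p *+ (2 * N + 1 - p) =
    (2 * N + 1 - p)%:R * avoiding_number R N (minn p (2 * N)).
  rewrite mulr_natl; have [//|pN2] := leqP p (2 * N).
  by have -> : (2 * N + 1 - p = 0)%N by lia.
have M1 : (matching_number N.+1)%:R = (2 * N + 1)%:R * (matching_number N)%:R :> R.
  by rewrite -natrM addn1 mul2n.
have M2 : (matching_number N.+2)%:R =
    (2 * N + 3)%:R * (matching_number N.+1)%:R :> R.
  by rewrite -natrM [matching_number N.+2]/=; congr (_ * _)%:R; lia.
have a0 : (matching_number N)%:R != 0 :> R.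
  by rewrite pnatr_eq0 -lt0n matching_number_gt0.
have b0 : (2 * N + 1)%:R != 0 :> R by rewrite pnatr_eq0 addn1.
have c0 : (2 * N + 3)%:R != 0 :> R by rewrite pnatr_eq0 addn3.
have M0 : (matching_number N.+2)%:R != 0 :> R.
  by rewrite pnatr_eq0 -lt0n matching_number_gt0.
have quot (u v w : R) : w != 0 -> u / v = (u / w) / (v / w).
  by move=> w0; rewrite invf_div mulrA divfK.
rewrite (quot _ _ _ M0) M2 M1 natrM.
move: (avoiding_number _ _ _) (avoiding_number _ _ _) (avoiding_number _ _ _).
move: (2 * N + 1 - p)%:R (2 * N + 1)%:R (2 * N + 3)%:R (matching_number N)%:R
  N.+1%:R a0 b0 c0 => w b c a n a0 b0 c0 G1 G2 G3.
by congr (_ / _); field; rewrite a0 b0 c0.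
Qed.

Lemma cvg_avoiding_ratio_trunc (R : realType) (x : R) : 0 < x -> x <= 2 ->
  (fun m => avoiding_number R m (Num.truncn (x * m%:R))
            / (matching_number m)%:R) @ \oo --> expR (- (x / 2)).
Proof.
move=> x0 x2; apply: (@cvg_avoiding_ratio _ (fun m => Num.truncn (x * m%:R)) _ 1) => m;
  have /truncn_itv/andP[le_x lt_x] : 0 <= x * m%:R by rewrite mulr_ge0 // ltW.
- rewrite -(ler_nat R) natrM; apply: le_trans le_x _.
  by rewrite ler_wpM2r.
- by rewrite ler_norml; apply/andP; split; move: lt_x; rewrite -natr1; lra.
Qed.

Theorem theorem6 (R : realType) (x : R) (hx0 : 0 < x) (hx2 : x <= 2) :
  (fun n : nat =>
     (n%:R - 1) * (bubble_count n (Num.truncn (x * (n%:R - 1))))%:R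
       / (\sum_(1 <= p < (2 * n - 2).+1) bubble_count n p)%:R : R)
    @ \oo -->
  expR 1 * (6 - x) / (2 * (4 * expR 1 - 2)) * expR (- (x / 2)).
Proof.
pose p N := Num.truncn (x * N.+1%:R).
have p_itv N : (p N)%:R <= x * N.+1%:R < (p N)%:R + 1.
  by rewrite natr1; apply: truncn_itv; rewrite mulr_ge0 // ltW.
have nS N : N.+1%:R = N%:R + 1 :> R by rewrite natr1.
have xN N : x * N%:R <= 2 * N%:R by rewrite ler_wpM2r.
pose r1 N : R := avoiding_number R N.+1 (p N) / (matching_number N.+1)%:R.
pose r2 N : R := avoiding_number R N (minn (p N) (2 * N)) / (matching_number N)%:R.
pose r3 N : R := avoiding_number R N.+2 (2 * N.+2) / (matching_number N.+2)%:R.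
have r1_lim : r1 @ \oo --> expR (- (x / 2)).
  have := cvg_avoiding_ratio_trunc hx0 hx2.
  by rewrite -cvg_shiftS.
(* The size is rounded from x (N + 1), hence the error x + 1 relative to x N. *)
have r2_lim : r2 @ \oo --> expR (- (x / 2)).
  apply: (@cvg_avoiding_ratio _ (fun N => minn (p N) (2 * N)) _ (x + 1)) => N.
    exact: geq_minr.
  have /andP[] := p_itv N; have := xN N; rewrite natr_min natrM nS minEle.
  by rewrite ler_norml; case: (leP (p N)%:R (2 * N%:R)) => *; apply/andP; split; lra.
have r3_lim : r3 @ \oo --> expR (- 1).
  have : (fun m => avoiding_number R m (2 * m) / (matching_number m)%:R) @ \oo -->
      expR (- (2 / 2)).
    apply: (@cvg_avoiding_ratio _ (fun m => 2 * m)%N 2 0) => m //.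
    by rewrite natrM subrr normr0.
  rewrite divff ?pnatr_eq0 // -(cvg_shiftn 2).
  by under eq_fun do rewrite addn2.
have cvg_affine_ratio (c d : nat) (s t : R) :
    t != 0 -> forall a b : nat -> R,
    (forall N, a N = s * N%:R + c%:R) -> (forall N, b N = t * N%:R + d%:R) ->
    (fun N => a N / b N) @ \oo --> s / t.
  move=> t0 a b aE bE; apply: (@cvg_quotient _ a b s t c%:R d%:R) => // N.
    by rewrite aE addrAC subrr add0r ger0_norm.
  by rewrite bE addrAC subrr add0r ger0_norm.
have q_lim : (fun N => (2 * N + 1 - p N)%:R / (2 * N + 1)%:R : R) @ \oo -->
    (2 - x) / 2.
  apply: (@cvg_quotient _ _ _ _ _ (x + 2) 1); last by rewrite pnatr_eq0.
    move=> N; have -> : (2 * N + 1 - p N)%:R =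
        2 * N%:R + 1 - Num.min (p N)%:R (2 * N%:R + 1) :> R.
      rewrite -natrM natr1 -natr_min -natrB ?geq_minr //; congr (_%:R); lia.
    have /andP[] := p_itv N; have := xN N; rewrite nS minEle.
    by rewrite ler_norml; case: (leP (p N)%:R (2 * N%:R + 1)) => *; apply/andP; split; lra.
  by move=> N; rewrite natrD natrM addrAC subrr add0r normr1.
set F := (X in X @ \oo --> _).
have lim_closed : (fun N =>
    ((2 * N.+1)%:R / (2 * N + 3)%:R * r1 N +
     N.+1%:R / (2 * N + 3)%:R * ((2 * N + 1 - p N)%:R / (2 * N + 1)%:R) * r2 N)
    / (2 - r3 N - 3 / (2 * N + 3)%:R)) @ \oo -->
  (2 / 2 * expR (- (x / 2)) + 1 / 2 * ((2 - x) / 2) * expR (- (x / 2)))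
    / (2 - expR (- 1) - 0 / 2).
  have t0 : (2 : R) != 0 by rewrite pnatr_eq0.
  have lin3 N : (2 * N + 3)%:R = 2 * N%:R + 3%:R :> R by rewrite natrD natrM.
  apply: cvgM; last first.
    apply: cvgV.
      have : expR (- 1) < 1 :> R by rewrite expR_lt1; lra.
      by move=> h; apply/eqP; lra.
    apply: cvgB; last first.
      by apply: (cvg_affine_ratio 3%N 3%N 0 2) => // N; rewrite mul0r add0r.
    by apply: cvgB => //; exact: cvg_cst.
  apply: cvgD; apply: cvgM => //.
    apply: (cvg_affine_ratio 2%N 3%N 2 2) => // N.
    by rewrite natrM nS; lra.
  apply: cvgM => //; apply: (cvg_affine_ratio 1%N 3%N 1 2) => // N.
  by rewrite mul1r natr1.
have -> : expR 1 * (6 - x) / (2 * (4 * expR 1 - 2)) * expR (- (x / 2)) =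
    (2 / 2 * expR (- (x / 2)) + 1 / 2 * ((2 - x) / 2) * expR (- (x / 2)))
      / (2 - expR (- 1) - 0 / 2) :> R.
  have e1 : 1 < expR 1 :> R by rewrite expR_gt1.
  rewrite (expRN 1); field.
  by apply/and3P; split; apply/eqP; lra.
(* With n = N + 2 all subtractions of the statement disappear; x > 0 makes the size
   positive eventually, as the count of bubbles requires. *)
rewrite -(cvg_shiftn 2); apply: (cvg_trans _ lim_closed); apply: near_eq_cvg.
have := nbhs_infty_gtr (1 / x); apply: filterS => N /= xN1.
have xN1' : 1 < x * N%:R by rewrite mulrC -ltr_pdivrMr.
have /andP[p_le p_gt] := p_itv N; rewrite nS in p_le p_gt.
rewrite addn2 /F.
have -> : N.+2%:R - 1 = N.+1%:R :> R by rewrite -[N.+2%:R]natr1 addrK.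
rewrite -/(p N) bubble_ratioE //.
  by rewrite -(ltr_nat R); lra.
by rewrite -(ler_nat R) natrM nS; have := xN N; lra.
Qed.
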